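(* Let $G$ be a group with subgroups $H, K, L$ and an element $\eta$, such that $H\backslash G$, with operation $Hg\rhd H\gamma = Hg\gamma^{-1}\eta\gamma$, is a connected quandle with $\mathrm{Inn}(H\backslash G) = G$ (acting by right multiplication). Let $c: H\backslash G\to K\backslash G$, $c(Hg) = Kg$, and $c': H\backslash G\to L\backslash G$, $c'(Hg) = Lg$, be rigid quotients, where in both cases the quandle structure is induced by the element $\eta$, which lies in both $Z(K)\cap H$ and $Z(L)\cap H$; that is, $Kg\rhd K\gamma = Kg\gamma^{-1}\eta\gamma$ and $Lg\rhd L\gamma = Lg\gamma^{-1}\eta\gamma$. Then $\Phi: K\backslash G\to L\backslash G$ defined by $\Phi(Kg) = Lg$ is a well-defined quandle homomorphism if and only if $K\subseteq L$. Moreover, in this case $\Phi$ is a rigid quotient and $\Phi\circ c = c'$.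
   Context: A quandle is a set $Q$ with two binary operations $\rhd, \rhd^{-1}$ such that for all $x,y,z\in Q$: (i) $x\rhd x = x$; (ii) $(x\rhd y)\rhd^{-1} y = x = (x\rhd^{-1} y)\rhd y$; (iii) $(x\rhd y)\rhd z = (x\rhd z)\rhd (y\rhd z)$. A quandle homomorphism is a map preserving $\rhd$ (hence $\rhd^{-1}$). For $x\in Q$ the symmetry $S_x$ is the automorphism $S_x(y) = y\rhd x$. The inner automorphism group $\mathrm{Inn}(Q)$ is the group generated by all the $S_x$, regarded as acting on $Q$ on the right ($q\cdot S_x = q\rhd x$, $q\cdot(gh) = (q\cdot g)\cdot h$). $Q$ is connected if it has exactly one orbit under $\mathrm{Inn}(Q)$. A surjective quandle homomorphism $h:Q\to R$ induces a surjective group homomorphism $\mathrm{Inn}(h):\mathrm{Inn}(Q)\to\mathrm{Inn}(R)$ determined by $S_x\mapsto S_{h(x)}$. A rigid quotient is a surjective quandle homomorphism $h$ such that $\mathrm{Inn}(h)$ is an isomorphism. $H\backslash G$ denotes the set of right cosets $Hg$, and $Z(K)$ the center of $K$. Every connected quandle $Q$ with $G=\mathrm{Inn}(Q)$ is identified with $H\backslash G$, where $H$ is the stabilizer of a chosen $q\in Q$, via $q\cdot g\leftrightarrow Hg$, with $\eta = S_q \in Z(H)$; in that case $G$ is generated by $\{g^{-1}\eta g\mid g\in G\}$ and acts faithfully on $H\backslash G$. For a rigid quotient $c$ of $Q$, $\mathrm{Inn}$ of the target is identified with $G$ via $\mathrm{Inn}(c)$. *)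

(* Defs.v *)
From HB Require Import structures.
From mathcomp Require Import all_boot boolp classical_sets.

Set Implicit Arguments.
Unset Strict Implicit.
Unset Printing Implicit Defensive.

Local Open Scope classical_set_scope.
Local Open Scope group_scope.

Reserved Notation "x |> y" (at level 40, left associativity).
Reserved Notation "x |>^-1 y" (at level 40, left associativity).

HB.mixin Record isQuandle (Q : Type) := {
  rhd : Q -> Q -> Q;
  rhdV : Q -> Q -> Q;
  rhdxx : forall x, rhd x x = x;
  rhdK : forall x y, rhdV (rhd x y) y = x;
  rhdVK : forall x y, rhd (rhdV x y) y = x;
  rhdD : forall x y z, rhd (rhd x y) z = rhd (rhd x z) (rhd y z)
}.

#[short(type="quandleType")]
HB.structure Definition Quandle := {Q of isQuandle Q}.

Notation "x |> y" := (rhd x y) : group_scope.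
Notation "x |>^-1 y" := (rhdV x y) : group_scope.

Definition quandle_hom (Q R : quandleType) (h : Q -> R) : Prop :=
  {morph h : x y / x |> y}.

(* The group of permutations of an arbitrary type, acting on the right:
   q . (f * g) = (q . f) . g. *)
Record permutation (T : Type) := Permutation {
  pfun :> T -> T;
  pinv : T -> T;
  pfunK : cancel pfun pinv;
  pinvK : cancel pinv pfun
}.

Section PermutationGroup.
Variable T : Type.
Implicit Types f g : permutation T.

Lemma permutationP f g : f =1 g -> f = g.
Proof.
case: f g => f f' fK f'K [g g' gK g'K] /= /funext efg; subst g.
have ef' : f' = g' by apply/funext => x; rewrite -[x in LHS]g'K fK.
by subst g'; congr Permutation; exact: Prop_irrelevance.
Qed.

Definition perm_one : permutation T := Permutation (frefl _) (frefl _).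
Definition perm_inv f := Permutation (@pinvK _ f) (@pfunK _ f).
Definition perm_mul f g : permutation T :=
  Permutation (can_comp (@pfunK _ g) (@pfunK _ f))
              (can_comp (@pinvK _ f) (@pinvK _ g)).

HB.instance Definition _ := gen_eqMixin (permutation T).
HB.instance Definition _ := gen_choiceMixin (permutation T).

Lemma perm_mulA : associative perm_mul.
Proof. by move=> f g h; apply: permutationP. Qed.
Lemma perm_mul1 : left_id perm_one perm_mul.
Proof. by move=> f; apply: permutationP. Qed.
Lemma perm_mulr1 : right_id perm_one perm_mul.
Proof. by move=> f; apply: permutationP. Qed.
Lemma perm_mulV : left_inverse perm_one perm_inv perm_mul.
Proof. by move=> f; apply: permutationP => x /=; rewrite pinvK. Qed.
Lemma perm_mulrV : right_inverse perm_one perm_inv perm_mul.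
Proof. by move=> f; apply: permutationP => x /=; rewrite pfunK. Qed.

HB.instance Definition _ := isGroup.Build (permutation T)
  perm_mulA perm_mul1 perm_mulr1 perm_mulV perm_mulrV.
End PermutationGroup.

Section Generated.
Variables (G : groupType) (A : set G).

Definition generated : {pred G} :=
  [pred x | `[< forall S : groupClosed G, A `<=` [set` S] -> x \in S >]].

Lemma generated1 : 1 \in generated.
Proof. by apply/asboolP => S _; exact: gpred1. Qed.
Lemma generatedM : mulg_closed generated.
Proof.
by move=> x y /asboolP xA /asboolP yA; apply/asboolP => S AS;
  apply: gpredM; [exact: xA | exact: yA].
Qed.
Lemma generatedV : invg_closed generated.
Proof.
by move=> x /asboolP xA; apply/asboolP => S AS; apply: gpredVr; exact: xA.
Qed.
HB.instance Definition _ := isMulClosed.Build G generated generatedM.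
HB.instance Definition _ := isMul1Closed.Build G generated generated1.
HB.instance Definition _ := isInvClosed.Build G generated generatedV.

Lemma mem_generated x : A x -> x \in generated.
Proof. by move=> Ax; apply/asboolP => S; exact. Qed.
End Generated.

Section Inn.
Variable Q : quandleType.
Implicit Types x y : Q.

Definition symm x : permutation Q :=
  @Permutation Q (fun y => y |> x) (fun y => y |>^-1 x)
    (fun y => rhdK y x) (fun y => rhdVK y x).

Definition Inn : Type := {f : permutation Q | f \in generated (range symm)}.

HB.instance Definition _ := SubChoice.on Inn.

Lemma Inn_group_closed : group_closed (generated (range symm)).
Proof. by split; [exact: gpred1 | exact: gpredF]. Qed.
HB.instance Definition _ :=
  SubChoice_isSubGroup.Build _ _ Inn Inn_group_closed.

Definition Inn_symm x : Inn :=
  exist _ (symm x) (mem_generated (imageT symm x)).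

Definition Inn_orbit x : set Q := range (fun f : Inn => val f x).

Definition connected : Prop := exists! O : set Q, exists x, O = Inn_orbit x.
End Inn.

(* [phi] is the homomorphism Inn(h) : S_x |-> S_(h x). For surjective [h] it
   exists and is unique, by [Inn_map_exists] and [Inn_map_unique] below. *)
Definition is_Inn_map (Q R : quandleType) (h : Q -> R)
    (phi : {multiplicative Inn Q -> Inn R}) : Prop :=
  forall x, phi (Inn_symm x) = Inn_symm (h x).

Definition rigid_quotient (Q R : quandleType) (h : Q -> R) : Prop :=
  [/\ quandle_hom h, range h = setT &
      exists2 phi : {multiplicative Inn Q -> Inn R},
        is_Inn_map h phi & bijective phi].

Section InnMap.
Variables (Q R : quandleType) (h : Q -> R).
Hypotheses (hM : quandle_hom h) (h_surj : range h = setT).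

Lemma multiplicative1 (G G' : groupType) (f : {multiplicative G -> G'}) :
  f 1 = 1.
Proof. by apply: (mulgI (f 1)); rewrite -gmulfM !mulg1. Qed.

Lemma Inn_map_unique (phi psi : {multiplicative Inn Q -> Inn R}) :
  is_Inn_map h phi -> is_Inn_map h psi -> phi =1 psi.
Proof.
move=> phiE psiE.
pose E : {pred permutation Q} :=
  [pred f | `[< exists2 u : Inn Q, val u = f & phi u = psi u >]].
have E1 : 1 \in E.
  by apply/asboolP; exists 1; rewrite ?multiplicative1.
have EM : mulg_closed E.
  move=> _ _ /asboolP[u <- eu] /asboolP[v <- ev]; apply/asboolP.
  by exists (u * v); rewrite ?gmulfM ?eu ?ev.
have mulV (f : {multiplicative Inn Q -> Inn R}) u : f u^-1 = (f u)^-1.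
  by apply: (mulgI (f u)); rewrite -gmulfM !mulgV multiplicative1.
have EV : invg_closed E.
  move=> _ /asboolP[u <- eu]; apply/asboolP.
  by exists (u^-1); rewrite ?mulV ?eu.
pose c := GroupClosed.Class (isInvClosed.Build _ E EV)
            (isMul1Closed.Build _ E E1) (isMulClosed.Build _ E EM).
pose S : groupClosed _ := GroupClosed.Pack c.
move=> u; have /asboolP/(_ S) := valP u.
have sub : range (@symm Q) `<=` [set` S].
  by move=> _ [x _ <-]; apply/asboolP; exists (Inn_symm x); rewrite ?phiE ?psiE.
by move=> /(_ sub)/asboolP[v /val_inj ->].
Qed.

Lemma Inn_lift (f : Inn Q) :
  exists g : Inn R, forall x, h (val f x) = val g (h x).
Proof.
pose E : {pred permutation Q} :=
  [pred f : permutation Q | `[< exists g : Inn R, forall x, h (f x) = val g (h x) >]].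
have E1 : 1 \in E by apply/asboolP; exists 1.
have EM : mulg_closed E.
  move=> u v /asboolP[u' eu] /asboolP[v' ev]; apply/asboolP.
  by exists (u' * v') => x /=; rewrite ev eu.
have EV : invg_closed E.
  move=> u /asboolP[u' eu]; apply/asboolP; exists (u'^-1) => x /=.
  by rewrite -[in RHS](pinvK u x) eu pfunK.
pose c := GroupClosed.Class (isInvClosed.Build _ E EV)
            (isMul1Closed.Build _ E E1) (isMulClosed.Build _ E EM).
pose S : groupClosed _ := GroupClosed.Pack c.
have /asboolP/(_ S) := valP f.
have sub : range (@symm Q) `<=` [set` S].
  move=> _ [x _ <-]; apply/asboolP; exists (Inn_symm (h x)) => y.
  exact: hM.
by move=> /(_ sub)/asboolP.
Qed.

Lemma Inn_map_exists :
  exists phi : {multiplicative Inn Q -> Inn R}, is_Inn_map h phi.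
Proof.
have [F FE] := choice Inn_lift.
have uniq (g g' : Inn R) : (forall x, val g (h x) = val g' (h x)) -> g = g'.
  move=> e; apply/val_inj/permutationP => r.
  have [x _ <-] : range h r by rewrite h_surj.
exact: e.
have FM : {morph F : f g / f * g}.
  by move=> f g; apply: uniq => x /=; rewrite -FE /= -!FE.
exists (HB.pack_for {multiplicative Inn Q -> Inn R} F
  (isMultiplicative.Build _ _ F FM)) => x /=.
by apply: uniq => y; rewrite -FE; exact: hM.
Qed.
End InnMap.

Definition rcoset (G : groupType) (H : groupClosed G) (g : G) : set G :=
  [set h * g | h in [set` H]].

Definition rcosets (G : groupType) (H : groupClosed G) : Type :=
  {A : set G | range (rcoset H) A}.

Definition to_rcosets (G : groupType) (H : groupClosed G) (g : G) : rcosets H :=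
  exist _ (rcoset H g) (imageT (rcoset H) g).

Definition center (G : groupType) (H : groupClosed G) : set G :=
  [set z | z \in H /\ {in H, forall x, commute z x}].

Section CosetQuandle.
Variables (G : groupType) (H : groupClosed G).

Lemma rcoset_refl g : rcoset H g g.
Proof. by exists 1; [exact: gpred1 | rewrite mul1g]. Qed.

Lemma rcosetP g x : rcoset H g x <-> x * g^-1 \in H.
Proof.
split=> [[h hH <-]|xgH]; first by rewrite mulgK.
by exists (x * g^-1); rewrite ?mulgVK.
Qed.

Lemma to_rcosetsP g g' : to_rcosets H g = to_rcosets H g' <-> g * g'^-1 \in H.
Proof.
split=> [/(congr1 (fun A => sval A g)) /= e|gg'].
  by apply/rcosetP; rewrite -e; exact: rcoset_refl.
apply: eq_exist => /=; apply/seteqP; split=> x /rcosetP xH; apply/rcosetP.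
  by rewrite -[x](mulgVK g) -mulgA gpredM.
by rewrite -[x](mulgVK g') -mulgA gpredM// -gpredV invgF.
Qed.

Lemma to_rcosets_surj (A : rcosets H) : exists g, A = to_rcosets H g.
Proof.
case: A => A pA; have [g _ eA] := pA.
by exists g; apply: eq_exist; rewrite /= eA.
Qed.

(* (H a, H b) |-> H a b^-1 z b, computed on representatives *)
Definition coset_op (z : G) (A B : rcosets H) : rcosets H :=
  let a := sval (cid (to_rcosets_surj A)) in
  let b := sval (cid (to_rcosets_surj B)) in
  to_rcosets H (a * b^-1 * z * b).

Lemma coset_opE z a b : center H z ->
  coset_op z (to_rcosets H a) (to_rcosets H b) =
  to_rcosets H (a * b^-1 * z * b).
Proof.
rewrite /coset_op => -[zH zC].
case: cid => a' /= /to_rcosetsP ha; case: cid => b' /= /to_rcosetsP hb.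
have {}zC : commute z (b * b'^-1) by exact: zC.
have -> : a' * b'^-1 * z * b' = a' * b^-1 * z * b.
  have -> : b'^-1 = b^-1 * (b * b'^-1) by rewrite mulKg.
  by rewrite !mulgA -(mulgA (a' * b^-1)) -(mulgA _ _ z) -zC !mulgA mulgVK.
apply/to_rcosetsP; rewrite gpredFC !(invgM, invgK, mulgA) mulgK mulgK.
by rewrite mulgVK.
Qed.
End CosetQuandle.

(* H\G with H a |> H b = H a b^-1 eta b, for eta central in H; the proof of
   centrality is a parameter of the type so that it carries the quandle
   structure. *)
Definition coset_quandle (G : groupType) (H : groupClosed G) (eta : G)
  (etaZ : center H eta) : Type := rcosets H.

Section CosetQuandleInstance.
Variables (G : groupType) (H : groupClosed G) (eta : G) (etaZ : center H eta).
Local Notation Q := (coset_quandle etaZ).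

Lemma center_inv z : center H z -> center H z^-1.
Proof.
move=> [zH zC]; split=> [|x xH]; first exact: gpredVr.
by apply: (mulgI z); rewrite mulVKg mulgA zC// mulgK.
Qed.

Lemma coset_rhdxx (A : Q) : coset_op eta A A = A.
Proof.
have [a ->] := to_rcosets_surj A; rewrite coset_opE//; apply/to_rcosetsP.
by rewrite mulgV mul1g mulgK; case: etaZ.
Qed.

Lemma coset_rhdK (A B : Q) : coset_op eta^-1 (coset_op eta A B) B = A.
Proof.
have [a ->] := to_rcosets_surj A; have [b ->] := to_rcosets_surj B.
rewrite !coset_opE//; last exact: center_inv.
by rewrite !mulgK !mulgVK.
Qed.

Lemma coset_rhdVK (A B : Q) : coset_op eta (coset_op eta^-1 A B) B = A.
Proof.
have [a ->] := to_rcosets_surj A; have [b ->] := to_rcosets_surj B.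
rewrite !coset_opE//; last exact: center_inv.
by rewrite mulgK !mulgVK.
Qed.

Lemma coset_rhdD (A B C : Q) :
  coset_op eta (coset_op eta A B) C =
  coset_op eta (coset_op eta A C) (coset_op eta B C).
Proof.
have [a ->] := to_rcosets_surj A; have [b ->] := to_rcosets_surj B.
have [c ->] := to_rcosets_surj C.
rewrite !coset_opE//; congr to_rcosets.
by rewrite !(invgM, invgK, mulgA) !(mulgK, mulgVK).
Qed.

HB.instance Definition _ :=
  isQuandle.Build Q coset_rhdxx coset_rhdK coset_rhdVK coset_rhdD.

Definition coset (g : G) : Q := to_rcosets H g.

Lemma coset_rhdE (a b : G) :
  coset a |> coset b = coset (a * b^-1 * eta * b).
Proof. exact: coset_opE. Qed.
End CosetQuandleInstance.

(* Main.v *)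
Require Import Defs.
From mathcomp Require Import all_boot boolp classical_sets.

(** A map [Phi] with [Phi (K g) = L g] exists precisely when [K g = K g']
    forces [L g = L g'], which amounts to [K] being contained in [L]: one
    direction evaluates [Phi] at [K k = K] for [k] in [K]
    ([coset_map_subset]), the other chooses representatives
    ([subset_coset_map]).  As [Phi] intertwines [c] with [c'], the rest
    is a cancellation property of rigid quotients ([rigid_quotient_cancel]):
    if [c] and [Phi \o c] are rigid then so is [Phi], because
    [Inn(Phi \o c) = Inn(Phi) \o Inn(c)] by uniqueness of the induced
    homomorphism, so that [Inn(Phi)] is a quotient of two bijections.  It
    is because [c] is surjective that [Phi] is a homomorphism at all: every
    identity to check holds on values of [c], where it is one for [c']
    ([quandle_hom_cancel]). *)

Set Implicit Arguments.
Unset Strict Implicit.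
Unset Printing Implicit Defensive.

Local Open Scope group_scope.

Lemma range_setT_surj (A B : Type) (f : A -> B) (b : B) :
  range f = setT -> exists a, f a = b.
Proof.
move=> f_surj.
have [a _ fa] : range f b by rewrite f_surj.
by exists a.
Qed.

Lemma is_Inn_map_comp (Q R S : quandleType) (f : Q -> R) (h : R -> S)
    (phi : {multiplicative Inn Q -> Inn R})
    (psi : {multiplicative Inn R -> Inn S}) :
  is_Inn_map f phi -> is_Inn_map h psi -> is_Inn_map (h \o f) (psi \o phi).
Proof. by move=> phiE psiE x /=; rewrite phiE psiE. Qed.

Lemma quandle_hom_cancel (Q R S : quandleType) (f : Q -> R) (h : R -> S) :
  quandle_hom f -> range f = setT -> quandle_hom (h \o f) -> quandle_hom h.
Proof.
move=> fM f_surj hfM r1 r2.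
have [x1 <-] := range_setT_surj r1 f_surj.
have [x2 <-] := range_setT_surj r2 f_surj.
by rewrite -fM; exact: hfM.
Qed.

Lemma range_comp_surj (A B C : Type) (f : A -> B) (h : B -> C) :
  range (h \o f) = setT -> range h = setT.
Proof.
move=> hf_surj; apply/seteqP; split=> // z _.
have [x <-] := range_setT_surj z hf_surj.
by exists (f x).
Qed.

(** [Inn(h) = Inn(h \o f) \o Inn(f)^-1], a composite of bijections. *)
Lemma rigid_quotient_cancel (Q R S : quandleType) (f : Q -> R) (h : R -> S) :
  rigid_quotient f -> rigid_quotient (h \o f) -> rigid_quotient h.
Proof.
move=> [fM f_surj [phi phiE phi_bij]] [hfM hf_surj [chi chiE chi_bij]].
have hM := quandle_hom_cancel fM f_surj hfM.
have h_surj := range_comp_surj hf_surj.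
split=> //; have [psi psiE] := Inn_map_exists hM h_surj.
exists psi => //; have [phi' phiK phi'K] := phi_bij.
have chi_fact : chi =1 psi \o phi.
  exact: Inn_map_unique chiE (is_Inn_map_comp phiE psiE).
apply: (@eq_bij _ _ (chi \o phi')) => [|u].
  by apply: bij_comp => //; exists phi.
by rewrite /= chi_fact /= phi'K.
Qed.

Section CosetMaps.
Variables (G : groupType) (K L : groupClosed G) (eta : G).
Variables (etaK : center K eta) (etaL : center L eta).

Lemma coset_map_subset (Phi : coset_quandle etaK -> coset_quandle etaL) :
  (forall g : G, Phi (coset etaK g) = coset etaL g) -> {subset K <= L}.
Proof.
move=> PhiE k kK.
have cosetK1 : coset etaK k = coset etaK 1.
  by apply/to_rcosetsP; rewrite invg1 mulg1.
have /to_rcosetsP : coset etaL k = coset etaL 1 by rewrite -!PhiE cosetK1.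
by rewrite invg1 mulg1.
Qed.

Lemma subset_coset_map : {subset K <= L} ->
  exists Phi : coset_quandle etaK -> coset_quandle etaL,
    forall g : G, Phi (coset etaK g) = coset etaL g.
Proof.
move=> subKL; have [rep repE] := choice (@to_rcosets_surj G K).
exists (fun A => coset etaL (rep A)) => g.
by apply/to_rcosetsP/subKL/to_rcosetsP; rewrite -repE.
Qed.

End CosetMaps.

Theorem theorem3p7 (G : groupType) (H K L : groupClosed G) (eta : G)
    (etaH : center H eta) (etaK : center K eta) (etaL : center L eta)
    (connectedQ : connected (coset_quandle etaH))
    (InnQ : exists2 rho : {multiplicative G -> Inn (coset_quandle etaH)},
       bijective rho &
       forall g x : G, val (rho g) (coset etaH x) = coset etaH (x * g))
    (c : coset_quandle etaH -> coset_quandle etaK)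
    (cE : forall g : G, c (coset etaH g) = coset etaK g)
    (c_rigid : rigid_quotient c)
    (c' : coset_quandle etaH -> coset_quandle etaL)
    (c'E : forall g : G, c' (coset etaH g) = coset etaL g)
    (c'_rigid : rigid_quotient c') :
  ((exists2 Phi : coset_quandle etaK -> coset_quandle etaL,
      forall g : G, Phi (coset etaK g) = coset etaL g & quandle_hom Phi)
   <-> {subset K <= L}) /\
  ({subset K <= L} ->
   exists2 Phi : coset_quandle etaK -> coset_quandle etaL,
     forall g : G, Phi (coset etaK g) = coset etaL g &
     rigid_quotient Phi /\ Phi \o c = c').
Proof.
have rigid_Phi : {subset K <= L} ->
    exists2 Phi : coset_quandle etaK -> coset_quandle etaL,
      forall g : G, Phi (coset etaK g) = coset etaL g &
      rigid_quotient Phi /\ Phi \o c = c'.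
  move=> subKL; have [Phi PhiE] := subset_coset_map etaK etaL subKL.
  have Phi_c : Phi \o c = c'.
    apply/funext => A; have [g ->] := to_rcosets_surj A.
    by rewrite /= [c _]cE PhiE -c'E.
  exists Phi => //; split=> //.
  by apply: (rigid_quotient_cancel c_rigid); rewrite Phi_c.
split=> //; split=> [[Phi PhiE _]|/rigid_Phi[Phi PhiE [[PhiM _ _] _]]].
  exact: coset_map_subset PhiE.
by exists Phi.
Qed.
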